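(* Let $A\in\mathbb{R}^{n,n}$ and $h<k$, where $h\in\mathbb{R}\cup\{-\infty\}$ and $k\in\mathbb{R}\cup\{+\infty\}$. Then $A$ is $\Omega_V(h,k)$-stable if and only if $A=(J-R)Q$ for some $J,R,Q\in\mathbb{R}^{n,n}$ such that $J^T=-J$, $R^T=R$, $Q\succ 0$, and $$kQ^{-1}\succ R\succ hQ^{-1}.$$
   Context: $\mathbb{R}^{n,n}$ denotes the real $n\times n$ matrices, $n\ge 1$. For a real matrix $X$, $X\succ 0$ means that $X$ is symmetric and positive definite, and $X\succ Y$ means $X-Y\succ 0$. The vertical strip region is $$\Omega_V(h,k)=\{x+iy\in\mathbb{C} : -k<x<-h\},$$ with $x,y\in\mathbb{R}$. If $h=-\infty$ the condition $x<-h$ and the condition $R\succ hQ^{-1}$ are vacuous; if $k=+\infty$ the condition $-k<x$ and the condition $kQ^{-1}\succ R$ are vacuous. For a set $\Omega\subseteq\mathbb{C}$, a matrix $A\in\mathbb{R}^{n,n}$ is called $\Omega$-stable if all its eigenvalues (in $\mathbb{C}$) lie in $\Omega$. *)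

(* Defs.v *)
From mathcomp Require Import all_boot all_order all_algebra.
From mathcomp Require Import complex.
From mathcomp Require Import boolp classical_sets reals constructive_ereal.
Set Implicit Arguments.
Unset Strict Implicit.
Unset Printing Implicit Defensive.
Import Order.TTheory GRing.Theory Num.Theory.
Local Open Scope classical_set_scope.
Local Open Scope complex_scope.
Local Open Scope ring_scope.

Definition mxposdef (F : realType) (n : nat) (X : 'M[F]_n) : Prop :=
  X^T = X /\ forall v : 'cV[F]_n, v != 0 -> 0 < (v^T *m X *m v) 0 0.

(* Loewner order: [mxsucc X Y] is X ≻ Y. *)
Definition mxsucc (F : realType) (n : nat) (X Y : 'M[F]_n) : Prop :=
  mxposdef (X - Y).

(* The order and the opposite are those of the extended reals, so an infinite
   h = -oo or k = +oo makes the corresponding inequality hold for every z. *)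
Definition vstrip (F : realType) (h k : \bar F) : set F[i] :=
  [set z : F[i] | (- k < (complex.Re z)%:E)%E /\ ((complex.Re z)%:E < - h)%E].

Definition mxstable (F : realType) (n : nat) (Omega : set F[i])
    (A : 'M[F]_n) : Prop :=
  forall z : F[i], eigenvalue (map_mx (real_complex F) A) z -> Omega z.

(* R ≻ h Q^-1, vacuous for h = -oo. The value at +oo is a convention that is
   never reached when h < k. *)
Definition mxlower (F : realType) (n : nat) (h : \bar F) (R Q : 'M[F]_n) :
    Prop :=
  match h with
  | r%:E => mxsucc R (r *: invmx Q)
  | -oo => True
  | +oo => False
  end%E.

(* k Q^-1 ≻ R, vacuous for k = +oo. The value at -oo is a convention that is
   never reached when h < k. *)
Definition mxupper (F : realType) (n : nat) (k : \bar F) (R Q : 'M[F]_n) :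
    Prop :=
  match k with
  | r%:E => mxsucc (r *: invmx Q) R
  | +oo => True
  | -oo => False
  end%E.

(* Main.v *)
Require Import Defs.
From mathcomp Require Import all_boot all_order all_algebra.
From mathcomp Require Import complex.
From mathcomp Require Import boolp classical_sets reals constructive_ereal.
From mathcomp Require Import ring lra.
Import Order.TTheory GRing.Theory Num.Theory.
Local Open Scope ring_scope.
Local Open Scope sesquilinear_scope.

(** With S = A Q^-1, a decomposition A = (J - R) Q amounts to a choice of Q:
    J and - R are forced to be the skew-symmetric and symmetric parts of S.
    Substituting v = Q u, the conditions k Q^-1 - R > 0 and R - h Q^-1 > 0 say
    that - k u^T Q u < u^T Q A u < - h u^T Q u for all nonzero u: the real
    numerical range of A, for the inner product given by Q, lies in
    the interval between - k and - h.

    If such a Q exists and a + i b is a (row) eigenvector of A for z, then Re z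
    is the quotient of the forms of A Q^-1 = J - R and of Q^-1, each summed
    over a and b ([eigen_rayleigh]). The form of J vanishes, so Re z lies in
    the same interval.

    Conversely, some inner product makes the numerical range as close as
    desired to the convex hull of the spectrum. Schur's theorem puts A in
    triangular form over the complex numbers, and conjugating by
    diag(1, t, t^2, ...) with t small shrinks the off-diagonal entries
    ([near_diagonalization]). If M A = B M with B nearly diagonal, then the
    Hermitian matrix M^* M is a suitable inner product. It is complex, but
    since A is real, its real part has the same values u^* M^* M u and
    Re (u^* M^* M A u) on real vectors u, so it works as well
    ([lyapunov_weight]). As the spectrum is finite and the strip is open, the
    eigenvalues stay at a positive distance from the boundary, and a close
    enough approximation stays in the strip ([stable_lyapunov]). *)

(** * Near-diagonalization of complex matrices *)

(** Conjugation by diag(t^i) multiplies the entry (i, j) by t^(i - j). In a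
    lower triangular matrix the exponent is positive off the diagonal wherever
    the entry is nonzero, so a small t shrinks all these entries at once. *)
Lemma trig_scaling {C : numFieldType} {n : nat} (T : 'M[C]_n) (e : C) :
  is_trig_mx T -> 0 < e ->
  exists2 t : C, 0 < t &
    forall i j : 'I_n, i != j -> `|t ^+ i * T i j / t ^+ j| <= e.
Proof.
move=> /is_trig_mxP Ttrig e_gt0.
pose c := \sum_i \sum_j `|T i j|.
have le_c i j : `|T i j| <= c.
  rewrite /c (bigD1 i) //= (bigD1 j) //= -addrA lerDl addr_ge0 //.
    by apply: sumr_ge0.
  by apply: sumr_ge0 => k _; apply: sumr_ge0.
have c_ge0 : 0 <= c by apply: sumr_ge0 => i _; apply: sumr_ge0.
have s_gt0 : 0 < e + c by rewrite ltr_wpDr.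
(* This t satisfies both t <= 1 and t * c <= e. *)
pose t := e / (e + c).
have t_gt0 : 0 < t by rewrite divr_gt0.
have t_le1 : t <= 1 by rewrite ler_pdivrMr // mul1r lerDl.
have tc_le : t * c <= e.
  by rewrite /t mulrAC ler_pdivrMr // ler_wpM2l ?lerDr // ltW.
exists t => // i j; rewrite neq_ltn => /orP[ltij|ltji].
  by rewrite Ttrig // mulr0 mul0r normr0 ltW.
rewrite mulrAC -exprB; [| exact: ltnW | by rewrite unitfE gt_eqF].
rewrite normrM normrX (gtr0_norm t_gt0).
apply: le_trans tc_le; apply: ler_pM => //; first by rewrite exprn_ge0 // ltW.
by apply: ler_iXnr => //; [rewrite subn_gt0 | exact: ltW].
Qed.

(** The diagonal [lam] is chosen before [e]: a tolerance can then be fixed in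
    terms of the eigenvalues. *)
Lemma near_diagonalization {C : numClosedFieldType} {n : nat} (A : 'M[C]_n) :
  (0 < n)%N ->
  exists2 lam : 'I_n -> C, forall i, eigenvalue A (lam i) &
    forall e : C, 0 < e -> exists M B : 'M[C]_n,
      [/\ M \in unitmx, M *m A = B *m M, forall i, B i i = lam i &
          forall i j, i != j -> `|B i j| <= e].
Proof.
move=> n_gt0; have [P Punitary PA_trig] := Schur A n_gt0.
have Punit := unitarymx_unit Punitary.
have {}PA_trig : is_trig_mx (conjmx P A) := PA_trig.
set T := conjmx P A in PA_trig.
have PA : P *m A = T *m P by rewrite /T conjumx // mulmxKV.
have eigT i : eigenvalue A (T i i).
  apply: (@eigenvalue_conjmx _ _ _ P).
  - by rewrite submx_full // row_full_unit.
  - by rewrite row_free_unit.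
  rewrite [_ \in _]eigenvalue_root_char char_poly_trig //.
  by rewrite (bigD1 i) //= rootM root_XsubC eqxx.
clearbody T; exists (fun i => T i i) => // e e_gt0.
have [t t_gt0 tT] := trig_scaling _ _ PA_trig e_gt0.
have t_neq0 k : t ^+ k != 0 by rewrite expf_neq0 // gt_eqF.
pose d : 'rV[C]_n := \row_(i < n) t ^+ i.
pose d' : 'rV[C]_n := \row_(i < n) (t ^+ i)^-1.
have d'd : diag_mx d' *m diag_mx d = 1%:M.
  rewrite mulmx_diag -diag_const_mx; congr diag_mx.
  by apply/rowP => i; rewrite !mxE mulVf.
have dunit : diag_mx d \in unitmx by have [] := mulmx1_unit d'd.
exists (diag_mx d *m P), (diag_mx d *m T *m diag_mx d'); split.
- by rewrite unitmx_mul dunit.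
- rewrite -(mulmxA (_ *m T)) (mulmxA (diag_mx d')) d'd mul1mx.
  by rewrite -!mulmxA PA.
- by move=> i; rewrite mul_diag_mx mul_mx_diag !mxE mulrAC divff ?mul1r.
- by move=> i j /tT; rewrite mul_diag_mx mul_mx_diag !mxE.
Qed.

(** By the arithmetic-geometric inequality, the off-diagonal terms
    contribute at most e * sum_(i, j) (|w_i|^2 + |w_j|^2) / 2. *)
Lemma herm_form_near_diag {C : numClosedFieldType} {n : nat} (B : 'M[C]_n)
    (e : C) (w : 'cV[C]_n) :
  (forall i j, i != j -> `|B i j| <= e) -> 0 <= e ->
  `|(w^t* *m B *m w) 0 0 - \sum_i B i i * `|w i 0| ^+ 2|
    <= e * n%:R * \sum_i `|w i 0| ^+ 2.
Proof.
move=> Be e_ge0.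
have -> : (w^t* *m B *m w) 0 0 =
    \sum_i \sum_j (w i 0)^* * B i j * w j 0.
  rewrite -mulmxA mxE; apply: eq_bigr => i _.
  rewrite !mxE big_distrr /=; apply: eq_bigr => j _.
  by rewrite mulrA.
rewrite -sumrB.
have AGM i j : `|w i 0| * `|w j 0| <= (`|w i 0| ^+ 2 + `|w j 0| ^+ 2) / 2.
  rewrite ler_pdivlMr // -subr_ge0.
  have -> : `|w i 0| ^+ 2 + `|w j 0| ^+ 2 - `|w i 0| * `|w j 0| * 2
      = (`|w i 0| - `|w j 0|) ^+ 2 by ring.
  by rewrite real_exprn_even_ge0 //; apply: rpredB; apply: normr_real.
have -> : e * n%:R * \sum_i `|w i 0| ^+ 2 =
    \sum_i \sum_j e * ((`|w i 0| ^+ 2 + `|w j 0| ^+ 2) / 2).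
  under [RHS]eq_bigr => i _ do
    rewrite -big_distrr -big_distrl big_split /= sumr_const card_ord.
  rewrite -big_distrr -big_distrl /= big_split /= sumr_const card_ord.
  by rewrite sumrMnl -(mulr_natr (\sum_i _)); field.
apply: le_trans (ler_norm_sum _ _ _) _; apply: ler_sum => i _.
rewrite (bigD1 i) //= [leRHS](bigD1 i) //=.
have -> : (w i 0)^* * B i i * w i 0 = B i i * `|w i 0| ^+ 2.
  by rewrite normCK; ring.
rewrite addrAC subrr add0r ler_wpDl //.
  by rewrite mulr_ge0 // divr_ge0 // addr_ge0 // exprn_ge0.
apply: le_trans (ler_norm_sum _ _ _) _; apply: ler_sum => j ij.
rewrite !normrM norm_conjC mulrAC [leLHS]mulrC.
by apply: ler_pM; rewrite ?mulr_ge0 // Be // eq_sym.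
Qed.

(** * Quadratic forms and positive definite matrices *)

Definition qform {R : pzRingType} {n : nat} (X : 'M[R]_n) (v : 'cV[R]_n) : R :=
  (v^T *m X *m v) 0 0.

Lemma qformD {R : pzRingType} {n : nat} (X Y : 'M[R]_n) (v : 'cV[R]_n) :
  qform (X + Y) v = qform X v + qform Y v.
Proof. by rewrite /qform mulmxDr mulmxDl mxE. Qed.

Lemma qformN {R : pzRingType} {n : nat} (X : 'M[R]_n) (v : 'cV[R]_n) :
  qform (- X) v = - qform X v.
Proof. by rewrite /qform mulmxN mulNmx mxE. Qed.

Lemma qformZ {R : comPzRingType} {n : nat} (a : R) (X : 'M[R]_n)
    (v : 'cV[R]_n) :
  qform (a *: X) v = a * qform X v.
Proof. by rewrite /qform -scalemxAr -scalemxAl mxE. Qed.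

Lemma qform_tr {R : comPzRingType} {n : nat} (X : 'M[R]_n) (v : 'cV[R]_n) :
  qform X^T v = qform X v.
Proof.
rewrite /qform; transitivity ((v^T *m X *m v)^T 0 0); last by rewrite mxE.
by rewrite !trmx_mul trmxK mulmxA.
Qed.

Lemma qform_congr {R : comPzRingType} {n : nat} (P X : 'M[R]_n)
    (v : 'cV[R]_n) :
  qform X (P *m v) = qform (P^T *m X *m P) v.
Proof. by rewrite /qform trmx_mul !mulmxA. Qed.

Lemma posdef_unitmx {F : realType} {n : nat} {Q : 'M[F]_n} :
  mxposdef Q -> Q \in unitmx.
Proof.
move=> [Qsym Qpos]; rewrite -row_free_unit -kermx_eq0.
apply/eqP/row_matrixP => i; rewrite row0.
set u := row i _; have uQ0 : u *m Q = 0 by rewrite -row_mul mulmx_ker row0.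
apply/eqP; case: eqVneq => // u_neq0.
have := Qpos u^T; rewrite trmx_eq0 => /(_ u_neq0).
by rewrite trmxK uQ0 mul0mx mxE ltxx.
Qed.

Lemma posdef_invmx {F : realType} {n : nat} {Q : 'M[F]_n} :
  mxposdef Q -> mxposdef (invmx Q).
Proof.
move=> Qpd; have Qu := posdef_unitmx Qpd; case: Qpd => Qsym Qpos.
have iQsym : (invmx Q)^T = invmx Q by rewrite trmx_inv Qsym.
split=> // v v_neq0.
have := Qpos (invmx Q *m v).
rewrite -/(qform _ _) qform_congr iQsym mulVmx // mul1mx; apply.
by apply: contraNneq v_neq0 => iQv0; rewrite -[v](mulKVmx Qu) iQv0 mulmx0.
Qed.

(** * Inner products adapted to a real matrix *)

Lemma Re_sum {F : rcfType} (I : Type) (r : seq I) (f : I -> F[i]) :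
  complex.Re (\sum_(i <- r) f i) = \sum_(i <- r) complex.Re (f i).
Proof. by apply: (big_morph _ _ erefl) => -[a b] [c d]. Qed.

Lemma Re_mul_real {F : rcfType} (z : F[i]) (a : F) :
  complex.Re (z * (real_complex F a)) = complex.Re z * a.
Proof. by case: z => x y /=; rewrite mulr0 subr0. Qed.

Lemma map_Re_mulmx {F : rcfType} {m n p : nat} (X : 'M[F[i]]_(m, n))
    (Y : 'M[F]_(n, p)) :
  map_mx (@complex.Re F) (X *m map_mx (real_complex F) Y) =
  map_mx (@complex.Re F) X *m Y.
Proof.
apply/matrixP => i j; rewrite !mxE Re_sum; apply: eq_bigr => k _.
by rewrite !mxE Re_mul_real.
Qed.

(** For real u the form of a complex matrix commutes with real parts; this is
    what turns a complex inner product into a real one. *)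
Lemma qform_Re {F : rcfType} {n : nat} (X : 'M[F[i]]_n) (u : 'cV[F]_n) :
  qform (map_mx (@complex.Re F) X) u =
  complex.Re (qform X (map_mx (real_complex F) u)).
Proof.
rewrite /qform -mulmxA -map_Re_mulmx -mulmxA map_trmx.
rewrite !mxE Re_sum; apply: eq_bigr => i _.
by rewrite !mxE mulrC [in RHS]mulrC Re_mul_real.
Qed.

(** A real inner product for which the numerical range of A is within e of the
    convex hull of the real parts of the eigenvalues. The weights p_i are
    the |w_i|^2, where w = M u are the coordinates of u in the basis that
    nearly diagonalizes A. *)
Lemma lyapunov_weight {F : realType} {n : nat} (A : 'M[F]_n) :
  (0 < n)%N ->
  exists2 lam : 'I_n -> F[i],
    forall i, eigenvalue (map_mx (real_complex F) A) (lam i) &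
    forall e : F, 0 < e -> exists2 Q : 'M[F]_n, mxposdef Q &
      forall u : 'cV[F]_n, exists p : 'I_n -> F,
        [/\ forall i, 0 <= p i, \sum_i p i = qform Q u &
            `|qform (Q *m A) u - \sum_i complex.Re (lam i) * p i|
              <= e * qform Q u].
Proof.
move=> n_gt0; set AC := map_mx _ A.
have [lam lamP near] := near_diagonalization AC n_gt0.
exists lam => // e e_gt0.
have n_gt0F : 0 < n%:R :> F by rewrite ltr0n.
(* The division by n cancels the factor n of [herm_form_near_diag]. *)
have [] := near (real_complex F (e / n%:R)).
  by rewrite (ltcR 0) divr_gt0.
move=> M [B [Munit MA Bdiag Boff]].
pose H := M^t* *m M.
pose Q := map_mx (@complex.Re F) H.
pose w (u : 'cV[F]_n) := M *m map_mx (real_complex F) u.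
pose p u i := complex.Re (`|w u i 0| ^+ 2).
have pE u i : real_complex F (p u i) = `|w u i 0| ^+ 2.
  by rewrite RRe_real // realX.
have p_ge0 u i : 0 <= p u i by rewrite -ler0c pE exprn_ge0.
have wt u : (w u)^t* = (map_mx (real_complex F) u)^T *m M^t*.
  rewrite trmx_mul map_mxM; congr (_ *m _).
  apply/matrixP => i j; rewrite !mxE.
  by apply/CrealP; apply/complex_realP; eexists.
have HE u : qform H (map_mx (real_complex F) u) = \sum_i `|w u i 0| ^+ 2.
  rewrite /qform /H mulmxA -wt -mulmxA mxE; apply: eq_bigr => i _.
  by rewrite !mxE normCK mulrC.
have QE u : qform Q u = \sum_i p u i by rewrite qform_Re HE Re_sum.
have QAE u : qform (Q *m A) u = complex.Re (((w u)^t* *m B *m w u) 0 0).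
  rewrite -map_Re_mulmx qform_Re /qform /H -/AC.
  by rewrite -(mulmxA _ M) MA wt !mulmxA.
exists Q.
  split=> [|u u_neq0].
    apply/matrixP => i j; rewrite !mxE !Re_sum; apply: eq_bigr => k _.
    by rewrite !mxE; case: (M k j) (M k i) => [a b] [c d] /=; ring.
  rewrite -/(qform _ _) QE.
  have : w u != 0.
    apply: contraNneq u_neq0 => wu0.
    rewrite -(map_mx_eq0 (real_complex F)).
    by rewrite -[map_mx _ u](mulKmx Munit) -/(w u) wu0 mulmx0.
  case/cV0Pn => i wi_neq0.
  rewrite (bigD1 i) //= ltr_pwDl ?sumr_ge0 //.
  by rewrite -(ltcR 0) pE exprn_gt0 // normr_gt0.
move=> u; exists (p u); split=> //.
have := herm_form_near_diag B _ (w u) Boff.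
rewrite ler0c => /(_ (ltW (divr_gt0 e_gt0 n_gt0F))).
set z := _ - _; set r := (_ * _)%R => z_le_r.
have -> : qform (Q *m A) u - \sum_i complex.Re (lam i) * p u i = complex.Re z.
  rewrite /z QAE; set c := (_ *m _) 0 0.
  have ReB (a b : F[i]) : complex.Re (a - b) = complex.Re a - complex.Re b.
    by case: a b => ? ? [].
  rewrite ReB Re_sum; congr (_ - _); apply: eq_bigr => i _.
  by rewrite Bdiag -pE Re_mul_real.
rewrite -lecR; apply: le_trans (normc_ge_Re z) _; apply: le_trans z_le_r _.
rewrite /r QE.
have -> : \sum_i `|w u i 0| ^+ 2 = real_complex F (\sum_i p u i).
  by rewrite rmorph_sum; apply: eq_bigr => i _; rewrite -pE.
have -> : real_complex F (e / n%:R) * n%:R = real_complex F e.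
  by rewrite -(rmorph_nat (real_complex F)) -rmorphM divfK // gt_eqF.
by rewrite -rmorphM.
Qed.

Lemma finite_margin {F : realFieldType} {n : nat} (f : 'I_n -> F) :
  (forall i, 0 < f i) -> exists2 d, 0 < d & forall i, d <= f i.
Proof.
move=> f_gt0; have s_ge0 (P : pred 'I_n) : 0 <= \sum_(i | P i) (f i)^-1.
  by apply: sumr_ge0 => i _; rewrite invr_ge0 ltW.
(* The summand 1 keeps the sum positive when n = 0. *)
exists (1 + \sum_i (f i)^-1)^-1 => [|i]; first by rewrite invr_gt0 ltr_wpDr.
rewrite invf_ple ?posrE ?ltr_wpDr //.
by rewrite (bigD1 i) //= addrCA lerDl addr_ge0.
Qed.

(** The two inequalities bound the Rayleigh quotient u^T Q A u / u^T Q u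
    strictly between - k and - h; an infinite bound makes its inequality
    vacuous. The tolerance e is at most half of the lower bounds dk and dh
    for the distances of the spectrum to the two sides of the strip, so the
    inequalities remain strict. *)
Lemma stable_lyapunov {F : realType} {n : nat} (A : 'M[F]_n) (h k : \bar F) :
  (0 < n)%N -> mxstable (vstrip h k) A ->
  exists2 Q : 'M[F]_n, mxposdef Q &
    forall u : 'cV[F]_n, u != 0 ->
      (forall r, k = r%:E -> 0 < r * qform Q u + qform (Q *m A) u) /\
      (forall r, h = r%:E -> 0 < - r * qform Q u - qform (Q *m A) u).
Proof.
move=> n_gt0 Astable; have [lam lamP near] := lyapunov_weight A n_gt0.
have [dk dk_gt0 dkP] : exists2 d : F, 0 < d &
    forall r i, k = r%:E -> d <= r + complex.Re (lam i).
  case: k Astable => [r Astable | Astable | Astable]; last 2 first.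
  - by exists 1.
  - by exists 1.
  have [|d d_gt0 dP] := finite_margin (fun i => r + complex.Re (lam i)).
    move=> i; have [+ _] := Astable _ (lamP i).
    by rewrite -EFinN lte_fin -subr_gt0 opprK addrC.
  by exists d => // r' i [<-].
have [dh dh_gt0 dhP] : exists2 d : F, 0 < d &
    forall r i, h = r%:E -> d <= - r - complex.Re (lam i).
  case: h Astable => [r Astable | Astable | Astable]; last 2 first.
  - by exists 1.
  - by exists 1.
  have [|d d_gt0 dP] := finite_margin (fun i => - r - complex.Re (lam i)).
    move=> i; have [_ +] := Astable _ (lamP i).
    by rewrite -EFinN lte_fin -subr_gt0.
  by exists d => // r' i [<-].
pose e := Num.min dk dh / 2.
have m_gt0 : 0 < Num.min dk dh by rewrite lt_min dk_gt0.
have e_ltk : e < dk.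
  by have : Num.min dk dh <= dk; [rewrite ge_min lexx | rewrite /e; lra].
have e_lth : e < dh.
  by have : Num.min dk dh <= dh; [rewrite ge_min lexx orbT | rewrite /e; lra].
have e_gt0 : 0 < e by rewrite divr_gt0.
have [Q Qpd QP] := near e e_gt0; exists Q => // u u_neq0.
have q_gt0 : 0 < qform Q u by case: Qpd => _; apply.
have [p [p_ge0 pq]] := QP u; rewrite ler_norml => /andP[lo hi].
have comb d (g : 'I_n -> F) : (forall i, d <= g i) ->
    d * qform Q u <= \sum_i g i * p i.
  move=> dg; rewrite -pq big_distrr /=; apply: ler_sum => i _.
  exact: ler_wpM2r.
split=> r rE.
  have := comb _ _ (fun i => dkP r i rE).
  under eq_bigr do rewrite mulrDl.
  rewrite big_split /= -big_distrr /= pq.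
  nra.
have := comb _ _ (fun i => dhP r i rE).
under eq_bigr do rewrite mulrBl.
rewrite sumrB -big_distrr /= pq.
nra.
Qed.

(** * The two implications *)

Lemma stable_decomposition {F : realType} {n : nat} (A : 'M[F]_n)
    (h k : \bar F) :
  (0 < n)%N -> (h < k)%E -> mxstable (vstrip h k) A ->
  exists J R Q : 'M[F]_n,
    [/\ A = (J - R) *m Q, J^T = - J, R^T = R, mxposdef Q &
        mxupper k R Q /\ mxlower h R Q].
Proof.
move=> n_gt0 lt_hk /(stable_lyapunov _ _ _ n_gt0)[Q Qpd QP].
have Qu := posdef_unitmx Qpd.
have iQsym := (posdef_invmx Qpd).1.
pose S := A *m invmx Q.
pose R := - (2^-1 *: (S + S^T)); pose J := 2^-1 *: (S - S^T).
have Rsym : R^T = R by rewrite /R linearN linearZ linearD /= trmxK addrC.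
have Jskew : J^T = - J.
  by rewrite /J linearZ linearB /= trmxK -scalerN opprB.
have JRE : J - R = S.
  rewrite /J /R opprK -scalerDr addrACA (addrC (- _)) subrr addr0.
  by rewrite -mulr2n -scaler_nat scalerA mulVf ?pnatr_eq0 // scale1r.
have qR v : qform R v = - qform S v.
  by rewrite /R qformN qformZ qformD qform_tr; field.
have qiQ v : qform (invmx Q) v = qform Q (invmx Q *m v).
  by rewrite qform_congr iQsym mulVmx // mul1mx.
have qS v : qform S v = qform (Q *m A) (invmx Q *m v).
  by rewrite qform_congr iQsym !mulmxA mulVmx // mul1mx.
have u_neq0 (v : 'cV[F]_n) : v != 0 -> invmx Q *m v != 0.
  by apply: contraNneq => iQv0; rewrite -[v](mulKVmx Qu) iQv0 mulmx0.
exists J, R, Q; split => //; first by rewrite JRE mulmxKV.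
split.
  case: k lt_hk QP => [r _ QP| // | ]; last by rewrite ltNge leNye.
  split=> [|v v_neq0]; first by rewrite linearB /= linearZ /= iQsym Rsym.
  rewrite -/(qform _ _) qformD qformN qformZ qR opprK qiQ qS.
  by have [+ _] := QP _ (u_neq0 v v_neq0); apply.
case: h lt_hk QP => [r _ QP| | //]; last by rewrite ltNge leey.
split=> [|v v_neq0]; first by rewrite linearB /= linearZ /= iQsym Rsym.
rewrite -/(qform _ _) qformD qR qformN qformZ qiQ qS.
have [_ /(_ r erefl)] := QP _ (u_neq0 v v_neq0); lra.
Qed.

(** Writing z = x + i y and the row eigenvector as a + i b, one has
    a A = x a - y b and b A = x b + y a. In the sum of the two forms the terms
    in y cancel by the symmetry of P. *)
Lemma eigen_rayleigh {F : rcfType} {n : nat} (A P : 'M[F]_n) (z : F[i]) :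
  P^T = P -> eigenvalue (map_mx (real_complex F) A) z ->
  exists a b : 'cV[F]_n, (a != 0) || (b != 0) /\
    qform (A *m P) a + qform (A *m P) b =
    complex.Re z * (qform P a + qform P b).
Proof.
move=> Psym /eigenvalueP[v vA v_neq0].
pose a := map_mx (@complex.Re F) v; pose b := map_mx (@complex.Im F) v.
pose x := complex.Re z; pose y := complex.Im z.
have aA : a *m A = x *: a - y *: b.
  rewrite -map_Re_mulmx vA; apply/matrixP => i j; rewrite !mxE.
  by rewrite /x /y; case: (z) (v i j) => ? ? [].
have bA : b *m A = x *: b + y *: a.
  (* Im v is written as - Re (i v) so that [map_Re_mulmx] applies. *)
  have -> : b = - map_mx (@complex.Re F) ('i%C *: v).
    by apply/matrixP => i j; rewrite !mxE; case: (v i j) => ? ? /=; ring.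
  rewrite mulNmx -map_Re_mulmx -scalemxAl vA; apply/matrixP => i j.
  by rewrite !mxE /x /y; case: (z) (v i j) => ? ? [? ?] /=; ring.
have cross : (a *m P *m b^T) 0 0 = (b *m P *m a^T) 0 0.
  transitivity ((a *m P *m b^T)^T 0 0); first by rewrite [RHS]mxE.
  by rewrite !trmx_mul trmxK Psym mulmxA.
exists a^T, b^T; split.
  rewrite !trmx_eq0 -negb_and; apply: contra v_neq0.
  move=> /andP[/eqP/rowP a0 /eqP/rowP b0].
  apply/eqP/rowP => j; move: (a0 j) (b0 j).
  by rewrite !mxE; case: (v 0 j) => ? ? /= -> ->.
rewrite /qform !trmxK !mulmxA aA bA !mulmxDl !mulNmx -!scalemxAl.
(* Unlike mxE, these leave the entries of the products unexpanded. *)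
have e00D (X Y : 'M[F]_1) : (X + Y) 0 0 = X 0 0 + Y 0 0 by rewrite mxE.
have e00N (X : 'M[F]_1) : (- X) 0 0 = - X 0 0 by rewrite mxE.
have e00Z c (X : 'M[F]_1) : (c *: X) 0 0 = c * X 0 0 by rewrite mxE.
by rewrite !(e00D, e00N, e00Z) cross -/x; ring.
Qed.

Lemma decomposition_stable {F : realType} {n : nat} (J R Q : 'M[F]_n)
    (h k : \bar F) :
  (h < k)%E -> J^T = - J -> mxposdef Q -> mxupper k R Q -> mxlower h R Q ->
  mxstable (vstrip h k) ((J - R) *m Q).
Proof.
move=> lt_hk Jskew Qpd upper lower z zeig.
have Qu := posdef_unitmx Qpd; have iQpd := posdef_invmx Qpd.
have [a [b [ab_neq0]]] := eigen_rayleigh _ _ _ iQpd.1 zeig.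
rewrite mulmxK //.
have qJ v : qform J v = 0.
  have := qform_tr J v; rewrite Jskew qformN; lra.
have pos (X : 'M[F]_n) : mxposdef X -> 0 < qform X a + qform X b.
  move=> [_ Xpos]; have X_ge0 v : 0 <= qform X v.
    have [-> | /Xpos/ltW//] := eqVneq v 0.
    by rewrite /qform mulmx0 mxE.
  case/orP: ab_neq0 => /Xpos v_gt0.
    exact: ltr_wpDr (X_ge0 b) v_gt0.
  exact: ltr_wpDl (X_ge0 a) v_gt0.
rewrite !qformD !qformN !qJ => ray.
have s_gt0 := pos _ iQpd; split.
  case: k lt_hk upper => [r _ /pos | _ _ | ]; last by rewrite ltNge leNye.
    rewrite !qformD !qformN !qformZ -EFinN lte_fin => upper; nra.
  exact: ltNyr.
case: h lt_hk lower => [r _ /pos | | _ _]; [|by rewrite ltNge leey|].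
  rewrite !qformD !qformN !qformZ -EFinN lte_fin => lower; nra.
exact: ltry.
Qed.

Theorem theorem2 (F : realType) (n : nat) (hn : (0 < n)%N) (A : 'M[F]_n)
    (h k : \bar F) (hk : (h < k)%E) :
  mxstable (vstrip h k) A <->
  exists J R Q : 'M[F]_n,
    [/\ A = (J - R) *m Q, J^T = - J, R^T = R, mxposdef Q &
        mxupper k R Q /\ mxlower h R Q].
Proof.
split; first exact: stable_decomposition.
move=> [J [R [Q [-> Jskew _ Qpd [upper lower]]]]].
exact: decomposition_stable.
Qed.
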